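(* Given two PMDs $M^Q(a|x)$ and $N^{Q'}(b|y)$, the following are equivalent: (a) $M^Q(a|x)\succeq N^{Q'}(b|y)$; (b) for all guessing games with post-information $\{\rho^R_{w,z}:w\in\mathcal{W},z\in\mathcal{Z}\}$, $P_{\operatorname{guess}}(M^Q(a|x);\rho^R_{w,z})\ge P_{\operatorname{guess}}(N^{Q'}(b|y);\rho^R_{w,z})$. Moreover, in (b) it suffices to consider only guessing games with $\mathcal{H}^R=\mathcal{H}^{Q'}$, $\mathcal{W}=\mathcal{Y}$, and $\mathcal{Z}=\mathcal{B}$.
   Context: A (classically) programmable measurement device (PMD) is a collection of POVMs $\{M^Q(a|x):a\in\mathcal{A},x\in\mathcal{X}\}$ on a Hilbert space $\mathcal{H}^Q$, with $M^Q(a|x)\ge 0$ and $\sum_a M^Q(a|x)=\mathds{1}^Q$ for all $x$ ($x$ is the program, $a$ the outcome). For PMDs $M^Q(a|x)$ on $\mathcal{H}^Q$ and $N^{Q'}(b|y)$ on $\mathcal{H}^{Q'}$, write $M^Q(a|x)\succeq N^{Q'}(b|y)$ whenever $N^{Q'}(b|y)=\sum_r\mu(r)\sum_{i,x,a}q(b|a,x,i,y,r)\,p(x|i,y,r)\,(\mathcal{E}^{Q'\to Q}_{i|r})^\dagger[M^Q(a|x)]$, where $\mu(r)$ is a probability distribution (shared randomness), $\{\mathcal{E}^{Q'\to Q}_{i|r}\}_i$ is a quantum instrument with classical outcome $i$ for each $r$ ($\mathcal{E}^\dagger$ the trace-dual map), and $p(x|i,y,r)$, $q(b|a,x,i,y,r)$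 are conditional probability distributions. A guessing game with post-information is given by a two-index ensemble $\{\rho^R_{w,z}:w\in\mathcal{W},z\in\mathcal{Z}\}$ of positive operators on $\mathcal{H}^R$ with $p(w,z):=\operatorname{Tr}[\rho^R_{w,z}]$ a normalized distribution: the referee picks $(w,z)$ with probability $p(w,z)$, sends the state $p(w,z)^{-1}\rho^R_{w,z}$ to the player, then later sends $w$, and the player must guess $z$. The optimal success probability with a PMD $M^Q(a|x)$ is $P_{\operatorname{guess}}(M^Q(a|x);\rho^R_{w,z}):=\max_{\mu,q,p,\mathcal{E}}\sum_{w,z}\sum_r\sum_{i,x,a}\mu(r)\,q(z|a,w,i,r)\,p(x|w,i,r)\,\operatorname{Tr}[\mathcal{E}^{R\to Q}_{i|r}(\rho^R_{w,z})\,M^Q(a|x)]$, maximizing over distributions $\mu$, conditional distributions $p,q$, and instruments $\{\mathcal{E}^{R\to Q}_{i|r}\}$. *)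

(* Defs.v *)
From HB Require Import structures.
From mathcomp Require Import all_boot all_order all_algebra.
From mathcomp Require Import classical_sets reals complex.
Set Implicit Arguments. Unset Strict Implicit. Unset Printing Implicit Defensive.
Import Order.TTheory GRing.Theory Num.Theory.
Local Open Scope ring_scope.

(* Finite-dimensional Hilbert spaces C^n, with C := R[i] for a real field R;
   operators on C^n are matrices 'M[R[i]]_n. *)

Section Quantum.
Variable R : realType.
Local Notation C := (R[i]).

Definition adjmx (m n : nat) (A : 'M[C]_(m, n)) : 'M[C]_(n, m) :=
  (map_mx Num.conj A)^T.

Definition psd (n : nat) (A : 'M[C]_n) : Prop :=
  forall v : 'cV[C]_n, 0 <= (adjmx v *m A *m v) 0 0.

Definition lin_map (n m : nat) (E : 'M[C]_n -> 'M[C]_m) : Prop :=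
  forall (a : C) (X Y : 'M[C]_n), E (a *: X + Y) = a *: E X + E Y.

(* components of an index of C^k (x) C^n *)
Definition idx1 (k n : nat) (i : 'I_(k * n)) : 'I_k :=
  (enum_val (cast_ord (esym (mxvec_cast k n)) i)).1.
Definition idx2 (k n : nat) (i : 'I_(k * n)) : 'I_n :=
  (enum_val (cast_ord (esym (mxvec_cast k n)) i)).2.

(* the ampliation id_k (x) E, acting blockwise on operators on C^k (x) C^n *)
Definition ampl (k n m : nat) (E : 'M[C]_n -> 'M[C]_m) (X : 'M[C]_(k * n))
  : 'M[C]_(k * m) :=
  \matrix_(i, j)
     E (\matrix_(a, b) X (mxvec_index (idx1 i) a) (mxvec_index (idx1 j) b))
       (idx2 i) (idx2 j).

Definition CP (n m : nat) (E : 'M[C]_n -> 'M[C]_m) : Prop :=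
  lin_map E /\ forall (k : nat) (X : 'M[C]_(k * n)), psd X -> psd (ampl E X).

Definition instrument (I : finType) (n m : nat)
  (E : I -> 'M[C]_n -> 'M[C]_m) : Prop :=
  (forall i, CP (E i)) /\
  forall X : 'M[C]_n, \tr (\sum_i E i X) = \tr X.

(* trace dual E^dagger : 'M_m -> 'M_n, characterised by
   Tr[E(X) Y] = Tr[X E^dagger(Y)] for linear E; written out entrywise
   (E^dagger(Y))_{j,i} = Tr[E(|i><j|) Y]. *)
Definition tdual (n m : nat) (E : 'M[C]_n -> 'M[C]_m) (Y : 'M[C]_m) : 'M[C]_n :=
  \matrix_(j, i) \tr (E (delta_mx i j) *m Y).

Definition distr (T : finType) (p : T -> R) : Prop :=
  (forall t, 0 <= p t) /\ \sum_t p t = 1.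

Definition PMD (n : nat) (A X : finType) (M : A -> X -> 'M[C]_n) : Prop :=
  (forall a x, psd (M a x)) /\ forall x, \sum_a M a x = 1%:M.

Local Open Scope complex_scope.

(* M(a|x) >= N(b|y): N is obtained from M by classical pre/post-processing,
   a quantum instrument and shared randomness r (over some finite set). *)
Definition simulates (n n' : nat) (A X B Y : finType)
  (M : A -> X -> 'M[C]_n) (N : B -> Y -> 'M[C]_n') : Prop :=
  exists (Rr I : finType) (mu : Rr -> R)
         (E : Rr -> I -> 'M[C]_n' -> 'M[C]_n)
         (p : I -> Y -> Rr -> X -> R)
         (q : A -> X -> I -> Y -> Rr -> B -> R),
    [/\ distr mu,
        (forall r, instrument (E r)),
        (forall i y r, distr (p i y r)),
        (forall a x i y r, distr (q a x i y r)) &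
        forall b y, N b y =
          \sum_r \sum_i \sum_x \sum_a
            ((mu r * q a x i y r b * p i y r x)%R)%:C *: tdual (E r i) (M a x)].

Definition guessing_game (d : nat) (W Z : finType)
  (rho : W -> Z -> 'M[C]_d) : Prop :=
  (forall w z, psd (rho w z)) /\ \sum_w \sum_z \tr (rho w z) = 1.

Definition success_values (n d : nat) (A X W Z : finType)
  (M : A -> X -> 'M[C]_n) (rho : W -> Z -> 'M[C]_d) : set R :=
  [set v | exists (Rr I : finType) (mu : Rr -> R)
         (E : Rr -> I -> 'M[C]_d -> 'M[C]_n)
         (p : W -> I -> Rr -> X -> R)
         (q : A -> W -> I -> Rr -> Z -> R),
    [/\ distr mu,
        (forall r, instrument (E r)),
        (forall w i r, distr (p w i r)),
        (forall a w i r, distr (q a w i r)) &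
        v%:C = \sum_w \sum_z \sum_r \sum_i \sum_x \sum_a
            ((mu r * q a w i r z * p w i r x)%R)%:C
              * \tr (E r i (rho w z) *m M a x)]].

Definition Pguess (n d : nat) (A X W Z : finType)
  (M : A -> X -> 'M[C]_n) (rho : W -> Z -> 'M[C]_d) : R :=
  sup (success_values M rho).

End Quantum.

(* Main.v *)
Require Import Defs.
From HB Require Import structures.
From mathcomp Require Import all_boot all_order all_algebra.
From mathcomp Require Import boolp classical_sets reals complex topology normedtype derive.
From mathcomp Require Import ring lra.
Set Implicit Arguments. Unset Strict Implicit. Unset Printing Implicit Defensive.
Import Order.TTheory GRing.Theory Num.Theory.
Import numFieldNormedType.Exports.
Local Open Scope ring_scope.

(* Shared and local randomness can be moved into the instrument: its outcome
   then dictates, deterministically, which program to run and how to relabel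
   the result.  In this form simulation is transitive, and the success
   probabilities of M are exactly the numbers sum Tr[rho_{w,z} N'(z|w)] with N'
   simulable by M; hence simulation implies domination in every game.
   Conversely, with the finite set of pairs of functions (Y -> X, A x Y -> B) as
   outcome set, the instruments form a compact convex set, so the PMDs N'(b|y)
   simulable by M do too.  If N is not among them, a linear functional
   N' |-> Re sum Tr[G_{y,b} N'(b|y)] strictly separates it from them.  Taking the
   hermitian part of G, adding positive operators that depend on y only (which
   shifts the value of all PMDs by the same constant) and normalising turns this
   functional into a guessing game in which N beats M. *)

(** * Positive matrices *)

Section PositiveMatrices.
Variable R : realType.
Local Notation C := (R[i]).

Lemma adjmxM m n p (A : 'M[C]_(m, n)) (B : 'M[C]_(n, p)) :
  adjmx (A *m B) = adjmx B *m adjmx A.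
Proof. by rewrite /adjmx map_mxM trmx_mul. Qed.

Lemma adjmxK m n (A : 'M[C]_(m, n)) : adjmx (adjmx A) = A.
Proof. by apply/matrixP=> i j; rewrite !mxE conjCK. Qed.

Lemma adjmxD m n (A B : 'M[C]_(m, n)) : adjmx (A + B) = adjmx A + adjmx B.
Proof. by apply/matrixP=> i j; rewrite !mxE rmorphD. Qed.

Lemma adjmxZ m n (a : C) (A : 'M[C]_(m, n)) :
  adjmx (a *: A) = Num.conj a *: adjmx A.
Proof. by apply/matrixP=> i j; rewrite !mxE rmorphM. Qed.

Lemma adjmx_delta m n i j : adjmx (delta_mx i j : 'M[C]_(m, n)) = delta_mx j i.
Proof. by apply/matrixP=> a b; rewrite !mxE conjC_nat andbC. Qed.

Lemma adjmx1 n : adjmx (1%:M : 'M[C]_n) = 1%:M.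
Proof. by rewrite /adjmx map_mx1 trmx1. Qed.

Lemma mxtrace_adj n (A : 'M[C]_n) : \tr (adjmx A) = Num.conj (\tr A).
Proof. by rewrite /mxtrace rmorph_sum; apply: eq_bigr => i _; rewrite !mxE. Qed.

Lemma psd_congr m n (K : 'M[C]_(m, n)) (A : 'M[C]_m) :
  psd A -> psd (adjmx K *m A *m K).
Proof. by move=> hA v; have := hA (K *m v); rewrite adjmxM !mulmxA. Qed.

Lemma psdD n (A B : 'M[C]_n) : psd A -> psd B -> psd (A + B).
Proof.
by move=> hA hB v; rewrite mulmxDr mulmxDl mxE addr_ge0 ?hA ?hB.
Qed.

Lemma psd0 n : psd (0 : 'M[C]_n).
Proof. by move=> v; rewrite mulmx0 mul0mx mxE. Qed.

Lemma psdZ n (a : C) (A : 'M[C]_n) : 0 <= a -> psd A -> psd (a *: A).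
Proof.
by move=> ha hA v; rewrite -scalemxAr -scalemxAl mxE mulr_ge0 ?hA.
Qed.

Lemma psd_sum n (I : Type) (s : seq I) (P : pred I) (F : I -> 'M[C]_n) :
  (forall i, P i -> psd (F i)) -> psd (\sum_(i <- s | P i) F i).
Proof. by move=> h; apply: big_ind => //; [exact: psd0 | exact: psdD]. Qed.

Lemma psd_gram m n (K : 'M[C]_(m, n)) : psd (adjmx K *m K).
Proof.
move=> v; rewrite mulmxA -adjmxM -mulmxA mxE sumr_ge0 // => i _.
by rewrite !mxE mulrC mul_conjC_ge0.
Qed.

Lemma psd1 n : psd (1%:M : 'M[C]_n).
Proof. by have := @psd_gram n n 1%:M; rewrite adjmx1 mulmx1. Qed.

(** Selecting rows and columns along any index map [f] is a congruence by a 0/1 matrix. This later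
    identifies operators on C^1 (x) C^n with operators on C^n. *)
Lemma psd_mxsub m n (f : 'I_n -> 'I_m) (A : 'M[C]_m) :
  psd A -> psd (mxsub f f A).
Proof.
have -> : mxsub f f A = adjmx (\matrix_(i, j) (i == f j)%:R) *m A *m
    (\matrix_(i, j) (i == f j)%:R).
  apply/matrixP=> i j; rewrite !mxE (bigD1 (f j)) //= big1 ?addr0.
    rewrite !mxE (bigD1 (f i)) //= big1 ?addr0.
      by rewrite !mxE !eqxx conjC_nat mul1r mulr1.
    by move=> k /negbTE hk; rewrite !mxE hk conjC_nat mul0r.
  by move=> k /negbTE hk; rewrite !mxE hk mulr0.
exact: psd_congr.
Qed.

Lemma delta_sandwich m n (A : 'M[C]_(m, n)) i j (p q : nat) (a : 'I_p) (b : 'I_q) :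
  delta_mx a i *m A *m delta_mx j b = A i j *: delta_mx a b.
Proof.
apply/matrixP=> x y; rewrite !mxE (bigD1 j) //= big1 ?addr0; last first.
  by move=> k /negbTE hk; rewrite !mxE hk mulr0.
rewrite !mxE (bigD1 i) //= big1 ?addr0; last first.
  by move=> k /negbTE hk; rewrite !mxE hk andbF mul0r.
rewrite !mxE !eqxx /= andbT; case: (x == a) => /=; last by rewrite !(mul0r, mulr0).
by rewrite mul1r.
Qed.

Lemma qf_delta2 n (A : 'M[C]_n) i j (c : C) :
  let v := delta_mx i 0 + c *: delta_mx j 0 : 'cV[C]_n in
  (adjmx v *m A *m v) 0 0 =
    A i i + c * A i j + Num.conj c * A j i + Num.conj c * c * A j j.
Proof.
rewrite /= adjmxD adjmxZ !adjmx_delta !(mulmxDl, mulmxDr) -!(scalemxAl, scalemxAr).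
rewrite !delta_sandwich !mxE /= !mulr1; ring.
Qed.

Lemma psd_diag_ge0 n (A : 'M[C]_n) i : psd A -> 0 <= A i i.
Proof.
move=> /(_ (delta_mx i 0)); rewrite adjmx_delta delta_sandwich !mxE /=.
by rewrite mulr1.
Qed.

Lemma psd_offdiag_ge0 n (A : 'M[C]_n) i j (c : C) : psd A -> Num.conj c * c = 1 ->
  0 <= A i i + A j j + c * A i j + Num.conj c * A j i.
Proof.
move=> hA hc; have := hA (delta_mx i 0 + c *: delta_mx j 0).
rewrite qf_delta2 hc mul1r.
suff -> : A i i + c * A i j + Num.conj c * A j i + A j j =
  A i i + A j j + c * A i j + Num.conj c * A j i by [].
by rewrite -!addrA; congr (_ + _); rewrite addrC -!addrA addrC -!addrA addrC -!addrA.
Qed.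

(** Polarization: nonnegative complex numbers are real, so testing on [e_i + c e_j] with [c = 1] and
    [c = 'i] makes [A i j + A j i] and ['i * (A i j - A j i)] real. *)
Lemma psd_herm n (A : 'M[C]_n) : psd A -> adjmx A = A.
Proof.
move=> hA; apply/matrixP=> j i; rewrite !mxE.
have dr k : A k k \is Num.real by apply: ger0_real; apply: psd_diag_ge0.
have drs : A i i + A j j \is Num.real by rewrite realD.
have h1 : A i j + A j i \is Num.real.
  have /ger0_real : 0 <= _ := @psd_offdiag_ge0 n A i j 1 hA (etrans (mulr1 _) (conjC1 _)).
  by rewrite conjC1 !mul1r -addrA => /(realB) /(_ drs); rewrite [X in X - _]addrC addrK.
have h2 : 'i * A i j - 'i * A j i \is Num.real.
  have hi : Num.conj 'i * 'i = 1 :> C by rewrite conjCi mulNr -expr2 sqrCi opprK.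
  have /ger0_real : 0 <= _ := @psd_offdiag_ge0 n A i j 'i hA hi.
  by rewrite conjCi mulNr -addrA => /(realB) /(_ drs); rewrite [X in X - _]addrC addrK.
move: h1 h2 => /CrealP; rewrite rmorphD /= => h1.
rewrite -mulrBr => /CrealP; rewrite rmorphM /= rmorphB /= conjCi mulNr -mulrN opprB.
move=> /(mulfI (neq0Ci _)) h2.
have : Num.conj (A i j) *+ 2 = A j i *+ 2.
  have -> : Num.conj (A i j) *+ 2 = (Num.conj (A i j) + Num.conj (A j i)) -
      (Num.conj (A j i) - Num.conj (A i j)) by ring.
  by rewrite h1 h2; ring.
by move/eqP; rewrite eqrMn2r // => /eqP.
Qed.

Lemma psd_entry_bound n (A : 'M[C]_n) i j : psd A -> `|A i j| <= A i i + A j j.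
Proof.
move=> hA; have [->|xn0] := eqVneq (A i j) 0.
  by rewrite normr0 addr_ge0 ?psd_diag_ge0.
have nn0 : `|A i j| != 0 by rewrite normr_eq0.
have nr : Num.conj `|A i j| = `|A i j| by rewrite conj_Creal ?normr_real.
(* The unit phase that rotates [A i j] onto the negative real axis; the form at [e_i + c e_j] then
   equals the two diagonal entries minus twice the modulus. *)
pose c := - Num.conj (A i j) / `|A i j|.
have cx : c * A i j = - `|A i j|.
  by rewrite /c mulrAC mulNr [_ * A i j]mulrC -normCK mulNr expr2 mulfK.
have hc : Num.conj c * c = 1.
  rewrite /c rmorphM fmorphV /= rmorphN /= conjCK nr.
  rewrite mulrACA mulrNN -normCK -invfM -expr2 divff //.
  by rewrite expf_neq0.
have := psd_offdiag_ge0 i j hA hc.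
have -> : Num.conj c * A j i = - `|A i j|.
  by rewrite -{1}(psd_herm hA) !mxE -rmorphM /= cx rmorphN /= nr.
rewrite cx -addrA -opprD subr_ge0; apply: le_trans.
by rewrite ler_wpDr.
Qed.

Lemma psd_tr_ge0 n (A : 'M[C]_n) : psd A -> 0 <= \tr A.
Proof. by move=> hA; apply: sumr_ge0 => i _; apply: psd_diag_ge0. Qed.

End PositiveMatrices.

(** * Completely positive maps and the trace dual *)

Section Maps.
Variable R : realType.
Local Notation C := (R[i]).

(** Diagonalizing [A] by a unitary [P] turns the trace into the sum of eigenvalues of [A] times
    diagonal entries of [P B P^*], all nonnegative. *)
Lemma psd_tr_mul_ge0 n (A B : 'M[C]_n) : psd A -> psd B -> 0 <= \tr (A *m B).
Proof.
move=> hA hB.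
have /hermitian_normalmx/orthomx_spectralP : A \is hermsymmx.
  by apply/is_hermitianmxP; rewrite expr0 scale1r -{1}(psd_herm hA) /adjmx map_trmx.
have hu := spectral_unitarymx A.
rewrite (invmx_unitary hu) -map_trmx.
set P := spectralmx A in hu *; set D := spectral_diag A => eA.
have hP : P *m adjmx P = 1%:M by apply/eqP; rewrite /adjmx map_trmx; exact: hu.
have hD : P *m A *m adjmx P = diag_mx D.
  by rewrite eA -/(adjmx P) !mulmxA hP mul1mx -mulmxA hP mulmx1.
rewrite eA -/(adjmx P) -mulmxA -mulmxA mxtrace_mulC -!mulmxA.
have hPB : psd (P *m B *m adjmx P).
  by have := @psd_congr R _ _ (adjmx P) B hB; rewrite adjmxK.
have hPA : psd (diag_mx D).
  by rewrite -hD; have := @psd_congr R _ _ (adjmx P) A hA; rewrite adjmxK.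
rewrite !mulmxA in hPB *; apply: sumr_ge0 => i _.
rewrite -!mulmxA mul_diag_mx mxE mulr_ge0 //; last by rewrite mulmxA psd_diag_ge0.
by have := psd_diag_ge0 i hPA; rewrite mxE eqxx mulr1n.
Qed.

Lemma idx1_mxvec_index k n (i : 'I_k) (a : 'I_n) : idx1 (mxvec_index i a) = i.
Proof. by rewrite /idx1 /mxvec_index cast_ordK enum_rankK. Qed.

Lemma idx2_mxvec_index k n (i : 'I_k) (a : 'I_n) : idx2 (mxvec_index i a) = a.
Proof. by rewrite /idx2 /mxvec_index cast_ordK enum_rankK. Qed.

Lemma sum_mxvec_index (V : nmodType) k n (F : 'I_(k * n) -> V) :
  \sum_q F q = \sum_i \sum_a F (mxvec_index i a).
Proof.
rewrite pair_bigA /= (reindex (uncurry (@mxvec_index k n))) /=; last exact: curry_mxvec_bij.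
by apply: eq_bigr => [[]].
Qed.

Lemma lin_map_sum n m (E : 'M[C]_n -> 'M[C]_m) : lin_map E ->
  forall (I : Type) (s : seq I) (P : pred I) (c : I -> C) (F : I -> 'M[C]_n),
  E (\sum_(i <- s | P i) c i *: F i) = \sum_(i <- s | P i) c i *: E (F i).
Proof.
move=> hE I s P c F.
have E0 : E 0 = 0 by have := hE (-1) 0 0; rewrite scaleN1r addNr scaleN1r addNr.
elim: s => [|i s IH]; first by rewrite !big_nil.
by rewrite !big_cons; case: (P i) => //; rewrite hE IH.
Qed.

Lemma lin_mapE n m (E : 'M[C]_n -> 'M[C]_m) (X : 'M[C]_n) : lin_map E ->
  E X = \sum_i \sum_j X i j *: E (delta_mx i j).
Proof.
move=> hE; rewrite {1}(matrix_sum_delta X).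
under eq_bigr do rewrite -[\sum_j _]scale1r.
rewrite lin_map_sum //; apply: eq_bigr => i _.
by rewrite scale1r lin_map_sum.
Qed.

Lemma tdualP n m (E : 'M[C]_n -> 'M[C]_m) (X : 'M[C]_n) (Y : 'M[C]_m) :
  lin_map E -> \tr (E X *m Y) = \tr (X *m tdual E Y).
Proof.
move=> hE; rewrite (lin_mapE _ hE) mulmx_suml raddf_sum.
apply: eq_bigr => i _; rewrite mulmx_suml raddf_sum mxE.
by apply: eq_bigr => j _; rewrite -scalemxAl /= mxtraceZ mxE.
Qed.

(** The trace pairing is nondegenerate, as matrix units read off entries; identities between trace
    duals can thus be checked on states. *)
Lemma tr_mulmx_inj n (A B : 'M[C]_n) :
  (forall X, \tr (X *m A) = \tr (X *m B)) -> A = B.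
Proof.
move=> h; apply/matrixP=> i j; have := h (delta_mx j i).
have tr_delta (D : 'M[C]_n) : \tr (delta_mx j i *m D) = D i j.
  rewrite -(mul_delta_mx (0 : 'I_1)) -mulmxA mxtrace_mulC /mxtrace big_ord1.
  by rewrite delta_sandwich !mxE /= mulr1.
by rewrite !tr_delta.
Qed.

Lemma tdualD n m (E : 'M[C]_n -> 'M[C]_m) (Y Z : 'M[C]_m) :
  tdual E (Y + Z) = tdual E Y + tdual E Z.
Proof. by apply/matrixP=> i j; rewrite !mxE mulmxDr raddfD. Qed.

Lemma tdual0 n m (E : 'M[C]_n -> 'M[C]_m) : tdual E 0 = 0.
Proof. by apply/matrixP=> i j; rewrite !mxE mulmx0 mxtrace0. Qed.

Lemma tdual_sum n m (E : 'M[C]_n -> 'M[C]_m) (I : Type) (s : seq I) (P : pred I)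
    (F : I -> 'M[C]_m) :
  tdual E (\sum_(i <- s | P i) F i) = \sum_(i <- s | P i) tdual E (F i).
Proof. exact: (big_morph _ (tdualD E) (tdual0 E)). Qed.

Lemma tdual_comp n m p (E : 'M[C]_n -> 'M[C]_m) (F : 'M[C]_m -> 'M[C]_p) Y :
  lin_map E -> lin_map F -> tdual (fun X => F (E X)) Y = tdual E (tdual F Y).
Proof.
move=> hE hF; apply: tr_mulmx_inj => X; rewrite -!tdualP //.
by move=> a U V; rewrite hE hF.
Qed.

Lemma tdual_id n (Y : 'M[C]_n) : tdual id Y = Y.
Proof. by apply: tr_mulmx_inj => X; rewrite -tdualP. Qed.

Lemma tdualZl n m (E : 'M[C]_n -> 'M[C]_m) c Y :
  tdual (fun X => c *: E X) Y = c *: tdual E Y.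
Proof. by apply/matrixP=> i j; rewrite !mxE -scalemxAl mxtraceZ. Qed.

Lemma CP_comp n m p (E : 'M[C]_n -> 'M[C]_m) (F : 'M[C]_m -> 'M[C]_p) :
  CP E -> CP F -> CP (fun X => F (E X)).
Proof.
move=> [lE hE] [lF hF]; split=> [a X Y|k X hX]; first by rewrite lE lF.
suff -> : ampl (fun X => F (E X)) X = ampl F (ampl E X) by apply/hF/hE.
apply/matrixP=> i j; rewrite !mxE; congr (F _ _ _).
apply/matrixP=> a b; rewrite !mxE !idx1_mxvec_index !idx2_mxvec_index.
by [].
Qed.

Lemma CPZ n m (E : 'M[C]_n -> 'M[C]_m) c : 0 <= c -> CP E -> CP (fun X => c *: E X).
Proof.
move=> hc [lE hE]; split=> [a X Y|k X hX].
  by rewrite lE scalerDr !scalerA mulrC.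
suff -> : ampl (fun X => c *: E X) X = c *: ampl E X by apply/psdZ/hE.
by apply/matrixP=> i j; rewrite !mxE.
Qed.

Lemma CP_sum n m (I : Type) (s : seq I) (P : pred I) (E : I -> 'M[C]_n -> 'M[C]_m) :
  (forall i, P i -> CP (E i)) -> CP (fun X => \sum_(i <- s | P i) E i X).
Proof.
move=> hE; split=> [a X Y|k X hX].
  rewrite scaler_sumr -big_split; apply: eq_bigr => i Pi.
  by case: (hE i Pi) => -> .
suff -> : ampl (fun X => \sum_(i <- s | P i) E i X) X = \sum_(i <- s | P i) ampl (E i) X.
  by apply: psd_sum => i Pi; case: (hE i Pi) => _; exact.
apply/matrixP=> i j; rewrite mxE !summxE; apply: eq_bigr => l _.
by rewrite mxE.
Qed.

Lemma CP_kraus n m (K : 'M[C]_(m, n)) : CP (fun X => K *m X *m adjmx K).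
Proof.
split=> [a X Y|k X hX].
  by rewrite mulmxDr mulmxDl -scalemxAr -scalemxAl.
(* The matrix of [1_k (x) K] in flattened indices: the ampliation of a Kraus map is congruence by
   it. *)
pose L : 'M[C]_(k * m, k * n) :=
  \matrix_(p, q) ((idx1 p == idx1 q)%:R * K (idx2 p) (idx2 q)).
suff -> : ampl (fun X => K *m X *m adjmx K) X = L *m X *m adjmx L.
  by rewrite -{1}[L]adjmxK; apply: psd_congr.
apply/matrixP=> p q; rewrite [in LHS]mxE [LHS]mxE [RHS]mxE sum_mxvec_index.
rewrite (bigD1 (idx1 q)) //= [X in _ = _ + X]big1 ?addr0; last first.
  move=> i hi; rewrite big1 // => a _.
  by rewrite !mxE idx1_mxvec_index eq_sym (negbTE hi) mul0r conjC0 mulr0.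
apply: eq_bigr => b _; rewrite !mxE idx1_mxvec_index idx2_mxvec_index eqxx mul1r.
congr (_ * _); rewrite sum_mxvec_index.
rewrite (bigD1 (idx1 p)) //= [X in _ = _ + X]big1 ?addr0; last first.
  move=> i hi; rewrite big1 // => a _.
  by rewrite !mxE idx1_mxvec_index eq_sym (negbTE hi) mul0r mul0r.
by apply: eq_bigr => a _; rewrite !mxE idx1_mxvec_index idx2_mxvec_index eqxx mul1r.
Qed.

Lemma CP_id n : CP (fun X : 'M[C]_n => X).
Proof.
have [_ h] := CP_kraus (1%:M : 'M[C]_n); split=> // k X hX.
suff -> : ampl id X = ampl (fun X => 1%:M *m X *m adjmx 1%:M) X by apply: h.
by apply/matrixP=> i j; rewrite [LHS]mxE [RHS]mxE adjmx1 mulmx1 mul1mx.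
Qed.

Lemma CP_psd n m (E : 'M[C]_n -> 'M[C]_m) X : CP E -> psd X -> psd (E X).
Proof.
move=> [_ hE] hX.
(* Complete positivity is used with a one-dimensional ancilla; [X] is reindexed to ['I_(1 * n)] and
   the result is reindexed back. *)
have hX' : psd (mxsub (@idx2 1 n) (@idx2 1 n) X) by apply: psd_mxsub.
have := psd_mxsub (mxvec_index (0 : 'I_1)) (hE 1 _ hX').
suff -> : mxsub (mxvec_index (0 : 'I_1)) (mxvec_index 0)
  (ampl E (mxsub (@idx2 1 n) (@idx2 1 n) X)) = E X by [].
apply/matrixP=> i j; rewrite !mxE !idx2_mxvec_index; congr (E _ _ _).
by apply/matrixP=> a b; rewrite !mxE !idx2_mxvec_index.
Qed.

Lemma tdual_psd n m (E : 'M[C]_n -> 'M[C]_m) Y : CP E -> psd Y -> psd (tdual E Y).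
Proof.
move=> hE hY v.
(* By duality the quadratic form of the dual is a trace of two positive matrices. *)
have -> : (adjmx v *m tdual E Y *m v) 0 0 = \tr (E (v *m adjmx v) *m Y).
  rewrite tdualP; last by case: hE.
  by rewrite -[v *m _ *m _]mulmxA mxtrace_mulC /mxtrace big_ord1.
apply: psd_tr_mul_ge0 => //; apply: CP_psd => //.
by have := psd_gram (adjmx v); rewrite adjmxK.
Qed.
End Maps.

(** * Deterministic form of a simulation *)

Section ProductDistributions.
Variables (R : realType) (T U : finType) (p : T -> U -> R).
Hypothesis p_distr : forall t, distr (p t).

(** The probability of [F] when its values are drawn independently, [F t] from [p t]. It presents a
    stochastic map as a mixture of functions. *)
Definition prod_weight (F : {ffun T -> U}) : R := \prod_t p t (F t).

Lemma prod_weight_ge0 F : 0 <= prod_weight F.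
Proof. by apply: prodr_ge0 => t _; case: (p_distr t). Qed.

Lemma prod_weight_sum : \sum_F prod_weight F = 1.
Proof.
rewrite /prod_weight -bigA_distr_bigA big1 // => t _.
by case: (p_distr t).
Qed.

Lemma prod_weight_marginal t0 u :
  \sum_F prod_weight F * (F t0 == u)%:R = p t0 u.
Proof.
pose h t v : R := p t v * (if t == t0 then (v == u)%:R else 1).
transitivity (\sum_(F : {ffun T -> U}) \prod_t h t (F t)).
  apply: eq_bigr => F _; rewrite big_split /=; congr (_ * _).
  rewrite (bigD1 t0) //= eqxx big1 ?mulr1 // => t /negbTE -> //.
rewrite -bigA_distr_bigA (bigD1 t0) //= [X in _ * X]big1; last first.
  move=> t /negbTE ht; rewrite /h ht.
  by under eq_bigr do rewrite mulr1; case: (p_distr t).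
rewrite mulr1 /h eqxx (bigD1 u) //= eqxx mulr1 big1 ?addr0 // => v /negbTE ->.
by rewrite mulr0.
Qed.

Lemma prod_weight_expect (V : lmodType R[i]) (psi : U -> V) t0 :
  \sum_F (prod_weight F)%:C%C *: psi (F t0) = \sum_u (p t0 u)%:C%C *: psi u.
Proof.
have psiE (F : {ffun T -> U}) : psi (F t0) = \sum_u ((F t0 == u)%:R : R)%:C%C *: psi u.
  rewrite (bigD1 (F t0)) //= eqxx scale1r big1 ?addr0 // => u.
  by rewrite eq_sym => /negbTE ->; rewrite scale0r.
under eq_bigr do rewrite psiE scaler_sumr.
rewrite exchange_big; apply: eq_bigr => u _.
under eq_bigr do rewrite scalerA -rmorphM.
by rewrite -scaler_suml -rmorph_sum prod_weight_marginal.
Qed.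
End ProductDistributions.

(** * Moving all randomness into the instrument *)

Section DeterministicSimulation.
Variable R : realType.
Local Notation C := (R[i]).
Local Open Scope complex_scope.

Definition det_sim (n n' : nat) (A X B Y I : finType)
    (E : I -> 'M[C]_n' -> 'M[C]_n) (f : I -> Y -> X) (g : I -> A -> Y -> B)
    (M : A -> X -> 'M[C]_n) (b : B) (y : Y) : 'M[C]_n' :=
  \sum_i \sum_(a | g i a y == b) tdual (E i) (M a (f i y)).

Definition det_simulates (n n' : nat) (A X B Y : finType)
    (M : A -> X -> 'M[C]_n) (N : B -> Y -> 'M[C]_n') : Prop :=
  exists (I : finType) (E : I -> 'M[C]_n' -> 'M[C]_n) (f : I -> Y -> X)
    (g : I -> A -> Y -> B),
    instrument E /\ forall b y, N b y = det_sim E f g M b y.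

Lemma det_of_simulates (n n' : nat) (A X B Y : finType)
    (M : A -> X -> 'M[C]_n) (N : B -> Y -> 'M[C]_n') :
  simulates M N -> det_simulates M N.
Proof.
case=> Rr [I [mu [E [p [q [hmu hE hp hq hN]]]]]].
pose P (r : Rr) (i : I) (F : {ffun Y -> X}) := prod_weight (fun y => p i y r) F.
pose Q (r : Rr) (i : I) (G : {ffun A * X * Y -> B}) :=
  prod_weight (fun t => q t.1.1 t.1.2 i t.2 r) G.
(* A new outcome records [r], [i] and a function for each of the two classical processings; the map
   of that outcome is [E r i] scaled by its probability [w]. *)
pose J : finType := (Rr * I * ({ffun Y -> X} * {ffun A * X * Y -> B}))%type.
pose w (k : J) := mu k.1.1 * (P k.1.1 k.1.2 k.2.1 * Q k.1.1 k.1.2 k.2.2).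
have w_ge0 k : 0 <= w k.
  rewrite /w !mulr_ge0 //; first by case: hmu.
    by apply: prod_weight_ge0.
  by apply: prod_weight_ge0.
exists J, (fun (k : J) Z => (w k)%:C *: E k.1.1 k.1.2 Z), (fun (k : J) y => k.2.1 y),
  (fun (k : J) a y => k.2.2 (a, k.2.1 y, y)); split.
  split=> [k|Z].
    by apply: CPZ; [rewrite ler0c | case: (hE k.1.1)].
  rewrite -(pair_bigA _ (fun ri fg => (w (ri, fg))%:C *: E ri.1 ri.2 Z)) /=.
  rewrite -(pair_bigA _ (fun r i => \sum_fg (w ((r, i), fg))%:C *: E r i Z)) /=.
  (* The weights of the two random functions sum to one, so only [mu] is left. *)
  transitivity (\tr (\sum_r (mu r)%:C *: \sum_i E r i Z)).
    congr (\tr _); apply: eq_bigr => r _; rewrite scaler_sumr; apply: eq_bigr => i _.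
    rewrite -scaler_suml -rmorph_sum; congr (_%:C *: _).
    rewrite /w /= -mulr_sumr -(pair_bigA _ (fun F G => P r i F * Q r i G)) /=.
    rewrite (eq_bigr (P r i)) ?prod_weight_sum ?mulr1 // => F _.
    by rewrite -mulr_sumr prod_weight_sum ?mulr1.
  rewrite raddf_sum /=; under eq_bigr do rewrite mxtraceZ (hE _).2.
  by rewrite -mulr_suml -rmorph_sum (proj2 hmu) mul1r.
move=> b y; rewrite hN /det_sim.
rewrite -(pair_bigA _ (fun (ri : Rr * I) (fg : {ffun Y -> X} * {ffun A * X * Y -> B}) => \sum_(a | fg.2 (a, fg.1 y, y) == b)
  tdual (fun Z => (w (ri, fg))%:C *: E ri.1 ri.2 Z) (M a (fg.1 y)))) /=.
rewrite -(pair_bigA _ (fun r i => \sum_(fg : {ffun Y -> X} * {ffun A * X * Y -> B}) \sum_(a | fg.2 (a, fg.1 y, y) == b)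
  tdual (fun Z => (w ((r, i), fg))%:C *: E r i Z) (M a (fg.1 y)))) /=.
apply: eq_bigr => r _; apply: eq_bigr => i _.
rewrite -(pair_bigA _ (fun (F : {ffun Y -> X}) (G : {ffun A * X * Y -> B}) => \sum_(a | G (a, F y, y) == b)
  tdual (fun Z => (w ((r, i), (F, G)))%:C *: E r i Z) (M a (F y)))) /=.
(* Averaging over [F] recovers [p] with [psi] as integrand; averaging over [G] below recovers [q],
   with the indicator of [b] inside [phi] as integrand. *)
pose psi x := \sum_a (mu r * q a x i y r b)%:C *: tdual (E r i) (M a x).
transitivity (\sum_x (p i y r x)%:C *: psi x).
  apply: eq_bigr => x _; rewrite scaler_sumr; apply: eq_bigr => a _.
  by rewrite scalerA -rmorphM; congr (_%:C *: _); rewrite mulrC.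
rewrite -(prod_weight_expect (fun y => hp i y r) psi y).
apply: eq_bigr => F _; rewrite -/(P r i F).
under [in RHS]eq_bigr do rewrite big_mkcond.
rewrite exchange_big scaler_sumr; apply: eq_bigr => a _ /=.
pose phi b' := if b' == b then tdual (E r i) (M a (F y)) else 0.
transitivity ((mu r * P r i F)%:C *: \sum_b' (q a (F y) i y r b')%:C *: phi b').
  rewrite (bigD1 b) //= [X in _ + X]big1 ?addr0; last first.
    by move=> b' /negbTE hb; rewrite /phi hb scaler0.
  rewrite /phi eqxx !scalerA -!rmorphM; congr (_%:C *: _).
  by rewrite mulrA [P r i F * _]mulrC.
rewrite -(prod_weight_expect (fun t : A * X * Y => hq t.1.1 t.1.2 i t.2 r) phi (a, F y, y)).
rewrite scaler_sumr; apply: eq_bigr => G _; rewrite /phi.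
case: eqP => _; last by rewrite !scaler0.
by rewrite tdualZl scalerA -rmorphM /w /= mulrA.
Qed.

Lemma distr_delta (T : finType) (t0 : T) : distr (fun t => (t0 == t)%:R : R).
Proof.
split=> [t|]; first by rewrite ler0n.
by rewrite (bigD1 t0) //= eqxx big1 ?addr0 // => t; rewrite eq_sym => /negbTE ->.
Qed.

Lemma distr_unit : distr (fun _ : unit => 1 : R).
Proof. by split=> //; rewrite big_const card_unit /= addr0. Qed.

Lemma sum_delta_pick (V : lmodType C) (T : finType) (t0 : T) (h : T -> V) :
  \sum_t ((t0 == t)%:R : R)%:C *: h t = h t0.
Proof.
rewrite (bigD1 t0) //= eqxx scale1r big1 ?addr0 // => t.
by rewrite eq_sym => /negbTE ->; rewrite scale0r.
Qed.

Lemma simulates_of_det (n n' : nat) (A X B Y : finType)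
    (M : A -> X -> 'M[C]_n) (N : B -> Y -> 'M[C]_n') :
  det_simulates M N -> simulates M N.
Proof.
case=> I [E [f [g [hE hN]]]].
exists unit, I, (fun=> 1), (fun=> E), (fun i y _ x => (f i y == x)%:R),
  (fun a x i y _ b => (g i a y == b)%:R); split=> //.
- exact: distr_unit.
- by move=> i y _; apply: distr_delta.
- by move=> a x i y _; apply: distr_delta.
move=> b y; rewrite hN (big_pred1 tt); last by case.
apply: eq_bigr => i _.
rewrite -(sum_delta_pick (f i y)
  (fun x => \sum_(a | g i a y == b) tdual (E i) (M a x))).
apply: eq_bigr => x _; rewrite scaler_sumr big_mkcond; apply: eq_bigr => a _.
rewrite mul1r; case: eqP => _; first by rewrite mul1r.
by rewrite mul0r scale0r.
Qed.

Lemma simulatesP (n n' : nat) (A X B Y : finType)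
    (M : A -> X -> 'M[C]_n) (N : B -> Y -> 'M[C]_n') :
  simulates M N <-> det_simulates M N.
Proof. by split; [exact: det_of_simulates | exact: simulates_of_det]. Qed.

Lemma mxtrace_mulZr n (c : C) (P Q : 'M[C]_n) : \tr (P *m (c *: Q)) = c * \tr (P *m Q).
Proof. by rewrite -scalemxAr mxtraceZ. Qed.

Lemma mxtrace_mul_sumr n (J : Type) (s : seq J) (Pr : pred J) (P : 'M[C]_n)
    (Q : J -> 'M[C]_n) :
  \tr (P *m \sum_(j <- s | Pr j) Q j) = \sum_(j <- s | Pr j) \tr (P *m Q j).
Proof. by rewrite mulmx_sumr raddf_sum. Qed.

(** Trace duality moves the instrument from the state to the measurement, so a strategy is a
    simulated PMD with program [w] and outcome [z]. *)
Lemma success_valuesP (n d : nat) (A X W Z : finType)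
    (M : A -> X -> 'M[C]_n) (rho : W -> Z -> 'M[C]_d) (v : R) :
  success_values M rho v <-> exists N : Z -> W -> 'M[C]_d,
    det_simulates M N /\ v%:C = \sum_w \sum_z \tr (rho w z *m N z w).
Proof.
split.
  case=> Rr [I [mu [E [p [q [hmu hE hp hq hv]]]]]].
  exists (fun z w => \sum_r \sum_i \sum_x \sum_a
            ((mu r * q a w i r z * p w i r x)%R)%:C *: tdual (E r i) (M a x)).
  split.
    apply: det_of_simulates; exists Rr, I, mu, E, (fun i w r => p w i r),
      (fun a x i w r => q a w i r).
    by split.
  rewrite hv; apply: eq_bigr => w _; apply: eq_bigr => z _.
  rewrite mxtrace_mul_sumr; apply: eq_bigr => r _.
  rewrite mxtrace_mul_sumr; apply: eq_bigr => i _.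
  rewrite mxtrace_mul_sumr; apply: eq_bigr => x _.
  rewrite mxtrace_mul_sumr; apply: eq_bigr => a _.
  by rewrite mxtrace_mulZr tdualP //; case: (hE r) => /(_ i) [].
case=> N [[I [E [f [g [hE hN]]]]] hv].
exists unit, I, (fun=> 1), (fun=> E), (fun w i _ x => (f i w == x)%:R),
  (fun a w i _ z => (g i a w == z)%:R); split=> //.
- exact: distr_unit.
- by move=> w i _; apply: distr_delta.
- by move=> a w i _; apply: distr_delta.
rewrite hv; apply: eq_bigr => w _; apply: eq_bigr => z _.
rewrite (big_pred1 tt); last by case.
rewrite hN mxtrace_mul_sumr; apply: eq_bigr => i _.
rewrite mxtrace_mul_sumr.
rewrite -(@sum_delta_pick C^o _ (f i w)
  (fun x => \sum_(a | g i a w == z) \tr (rho w z *m tdual (E i) (M a x)))).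
apply: eq_bigr => x _; rewrite scaler_sumr big_mkcond; apply: eq_bigr => a _.
rewrite mul1r -tdualP; last by case: hE => /(_ i) [].
case: eqP => _; first by rewrite mul1r.
by rewrite !mul0r.
Qed.
End DeterministicSimulation.

(** * Simulation decreases the guessing probability *)

Section SimulationOrder.
Variable R : realType.
Local Notation C := (R[i]).
Local Open Scope complex_scope.

Lemma det_simulates_refl (n : nat) (A X : finType) (M : A -> X -> 'M[C]_n) : det_simulates M M.
Proof.
exists unit, (fun _ Z => Z), (fun _ x => x), (fun _ a _ => a); split.
  by split=> [_|Z]; [exact: CP_id | rewrite (big_pred1 tt) //; case].
move=> a x; rewrite /det_sim (big_pred1 tt); last by case.
by rewrite big_pred1_eq tdual_id.
Qed.

(** States pass through [E'] and then [E]; the program [f' i' w] meant for [N] is translated by [f]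
    into one for [M], and outcomes are relabelled by [g] and then [g']. *)
Lemma det_simulates_trans (n n' n'' : nat) (A X B Y Z W : finType)
    (M : A -> X -> 'M[C]_n) (N : B -> Y -> 'M[C]_n') (K : Z -> W -> 'M[C]_n'') :
  det_simulates M N -> det_simulates N K -> det_simulates M K.
Proof.
case=> I [E [f [g [hE hN]]]] [I' [E' [f' [g' [hE' hK]]]]].
exists (I' * I)%type, (fun k U => E k.2 (E' k.1 U)),
  (fun k w => f k.2 (f' k.1 w)), (fun k a w => g' k.1 (g k.2 a (f' k.1 w)) w).
split.
  split=> [k|U]; first by apply: CP_comp; [exact: hE'.1 | exact: hE.1].
  rewrite -(pair_bigA _ (fun i' i => E i (E' i' U))) /= raddf_sum /=.
  under eq_bigr do rewrite hE.2.
  by rewrite -[RHS]hE'.2 raddf_sum.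
move=> z w; rewrite hK /det_sim.
rewrite -(pair_bigA _ (fun i' i => \sum_(a | g' i' (g i a (f' i' w)) w == z)
  tdual (fun U => E i (E' i' U)) (M a (f i (f' i' w))))) /=.
apply: eq_bigr => i' _.
transitivity (\sum_(b | g' i' b w == z) \sum_i \sum_(a | g i a (f' i' w) == b)
    tdual (E' i') (tdual (E i) (M a (f i (f' i' w))))).
  apply: eq_bigr => b _; rewrite hN tdual_sum; apply: eq_bigr => i _.
  by rewrite tdual_sum.
rewrite exchange_big; apply: eq_bigr => i _ /=.
rewrite [RHS](eq_bigr (fun a => tdual (E' i') (tdual (E i) (M a (f i (f' i' w))))));
  last by move=> a _; apply: tdual_comp; [case: (hE'.1 i') | case: (hE.1 i)].
rewrite [RHS](partition_big (fun a => g i a (f' i' w)) (fun b => g' i' b w == z)) //=.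
apply: eq_bigr => b hb; apply: eq_bigl => a.
by case: eqP => [->|]; rewrite ?hb ?andbF.
Qed.

Lemma instrument_tdual1 (I : finType) n m (E : I -> 'M[C]_n -> 'M[C]_m) :
  instrument E -> \sum_i tdual (E i) 1%:M = 1%:M.
Proof.
move=> [hE tE]; apply: tr_mulmx_inj => U; rewrite mulmx1 -[RHS]tE mxtrace_mul_sumr.
rewrite [RHS]raddf_sum /=; apply: eq_bigr => i _.
by rewrite -tdualP ?mulmx1 //; case: (hE i).
Qed.

Lemma det_simulates_PMD (n n' : nat) (A X B Y : finType)
    (M : A -> X -> 'M[C]_n) (N : B -> Y -> 'M[C]_n') :
  PMD M -> det_simulates M N -> PMD N.
Proof.
move=> [hM tM] [I [E [f [g [hE hN]]]]]; split=> [b y|y].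
  rewrite hN; apply: psd_sum => i _; apply: psd_sum => a _.
  by apply: tdual_psd; [case: hE | ].
under eq_bigr do rewrite hN; rewrite exchange_big -(instrument_tdual1 hE) /=.
apply: eq_bigr => i _.
rewrite -(tM (f i y)) tdual_sum.
by rewrite [RHS](partition_big (fun a => g i a y) predT).
Qed.

Lemma guess_bounds (d : nat) (W Z : finType) (N : Z -> W -> 'M[C]_d)
    (rho : W -> Z -> 'M[C]_d) (v : R) : PMD N -> guessing_game rho ->
  v%:C = \sum_w \sum_z \tr (rho w z *m N z w) -> 0 <= v <= 1.
Proof.
move=> [hN tN] [hrho trho] hv.
have h0 w z z' : 0 <= \tr (rho w z *m N z' w) by apply: psd_tr_mul_ge0.
have e1 : 1%:C = \sum_w \sum_z \tr (rho w z) :> C by exact: esym trho.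
rewrite -!lecR hv e1.
apply/andP; split.
  by apply: sumr_ge0 => w _; apply: sumr_ge0 => z _.
apply: ler_sum => w _; apply: ler_sum => z _.
(* Inserting the resolution of the identity splits [\tr (rho w z)] into nonnegative terms, one of
   which is the term to be bounded. *)
rewrite -[X in _ <= \tr X]mulmx1 -(tN w) mxtrace_mul_sumr (bigD1 z) //=.
by rewrite lerDl sumr_ge0.
Qed.

Section Games.
Variables (n d : nat) (A X W Z : finType).
Variables (M : A -> X -> 'M[C]_n) (rho : W -> Z -> 'M[C]_d).
Hypotheses (hM : PMD M) (hrho : guessing_game rho).

Lemma success_values_bounds v : success_values M rho v -> 0 <= v <= 1.
Proof.
by move/success_valuesP => [N [/(det_simulates_PMD hM) hN hv]]; apply: guess_bounds hv.
Qed.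

Lemma Pguess_ge v : success_values M rho v -> v <= Pguess M rho.
Proof.
move=> hv; apply: ub_le_sup => //; exists 1 => u /success_values_bounds.
by case/andP.
Qed.

(** The supremum of the empty set is 0, whence the assumption [0 <= c]. *)
Lemma Pguess_le c : 0 <= c -> (forall v, success_values M rho v -> v <= c) ->
  Pguess M rho <= c.
Proof.
move=> c0 hc; rewrite /Pguess.
have [->|/set0P ne] := eqVneq (success_values M rho) set0; first by rewrite sup0.
exact: ge_sup.
Qed.

Lemma Pguess_ge0 : 0 <= Pguess M rho.
Proof.
have [e|/set0P[v hv]] := eqVneq (success_values M rho) set0.
  by rewrite /Pguess e sup0.
by apply: le_trans (Pguess_ge hv); have /andP[] := success_values_bounds hv.
Qed.
End Games.

Lemma simulates_Pguess_le (n n' d : nat) (A X B Y W Z : finType)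
    (M : A -> X -> 'M[C]_n) (N : B -> Y -> 'M[C]_n') (rho : W -> Z -> 'M[C]_d) :
  PMD M -> guessing_game rho -> simulates M N -> Pguess N rho <= Pguess M rho.
Proof.
move=> hM hrho /simulatesP hMN; apply: Pguess_le; first exact: Pguess_ge0.
move=> v /success_valuesP [K [hNK hv]]; apply: Pguess_ge => //.
by apply/success_valuesP; exists K; split=> //; apply: det_simulates_trans hNK.
Qed.

(** Measuring in the standard basis and preparing [e_i0] gives an instrument between any two spaces
    with nonzero target. It serves as witness when there is no program and the simulation equations
    are vacuous. *)
Lemma measure_and_reset_instrument n m (i0 : 'I_m) :
  instrument (fun (k : 'I_n) (U : 'M[C]_n) =>
    delta_mx i0 k *m U *m adjmx (delta_mx i0 k : 'M[C]_(m, n))).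
Proof.
split=> [k|U]; first exact: CP_kraus.
rewrite raddf_sum; apply: eq_bigr => k _ /=.
rewrite adjmx_delta delta_sandwich mxtraceZ /mxtrace (bigD1 i0) //= big1 ?addr0.
  by rewrite mxE eqxx mulr1.
by move=> j /negbTE hj; rewrite mxE hj.
Qed.

Lemma simulates_no_program (n n' : nat) (A X B Y : finType)
    (M : A -> X -> 'M[C]_n) (N : B -> Y -> 'M[C]_n') :
  (0 < n)%N -> (Y -> False) -> simulates M N.
Proof.
move=> n_gt0 hY; apply/simulatesP.
have := @measure_and_reset_instrument n' n (Ordinal n_gt0).
set E := fun k => _ => hE.
exists 'I_n', E, (fun _ y => False_rect X (hY y)), (fun _ _ y => False_rect B (hY y)).
by split=> // b y; case: (hY y).
Qed.
End SimulationOrder.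

(** * Separation from a compact convex set *)

Section Separation.
Variables (R : realType) (D : nat).
Implicit Types (l : 'rV[R]_D -> R) (K : set 'rV[R]_D).

Lemma scalar_rV_continuous l : scalar l -> continuous l.
Proof.
move=> hl.
have l0 : l 0 = 0 by have := hl (-1) 0 0; rewrite scaleN1r addNr mulN1r addNr.
have -> : l = fun v => \sum_j v 0 j * l (delta_mx 0 j).
  apply/funext => v; rewrite {1}(row_sum_delta v).
  elim/big_rec2: _ => // j x u _ <-.
  by rewrite hl.
apply: continuous_big => [|j _ v].
  exact: add_continuous.
have cj : {for v, continuous (fun v : 'rV[R]_D => v 0 j)} by exact: coord_continuous.
have cl : {for v, continuous (fun _ : 'rV[R]_D => l (delta_mx 0 j))} by exact: cst_continuous.
exact: (continuousM cj cl).
Qed.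

Lemma closed_halfspace l c : scalar l -> closed [set v | c <= l v]%classic.
Proof.
move=> hl; apply: (@closed_comp _ _ l [set x | c <= x]%classic); last exact: closed_ge.
by move=> v _; apply: scalar_rV_continuous.
Qed.

Lemma sqr_dist_expand (T : finType) (a d : T -> R) s :
  \sum_t (a t + s * d t) ^+ 2 =
  \sum_t a t ^+ 2 + s * (2 * \sum_t a t * d t) + s ^+ 2 * \sum_t d t ^+ 2.
Proof.
rewrite !mulr_sumr -!big_split; apply: eq_bigr => t _ /=.
by ring.
Qed.

(** The variational inequality at a minimum: dividing by [s] and letting [s] tend to 0 would give
    it, but a single well-chosen [s] suffices. *)
Lemma first_order_le0 (B G : R) : 0 <= G ->
  (forall s, 0 <= s <= 1 -> s * (2 * B) <= s ^+ 2 * G) -> B <= 0.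
Proof.
move=> G0 h; rewrite leNgt; apply/negP => B0.
have BG : 0 < B + G by rewrite ltr_wpDr.
pose s := B / (B + G).
have s0 : 0 < s by rewrite divr_gt0.
have sE : s * (B + G) = B by rewrite /s divfK ?gt_eqF.
have s1 : s <= 1 by rewrite ler_pdivrMr // mul1r lerDl.
have := h s; rewrite (ltW s0) s1 => /(_ isT).
rewrite expr2 -mulrA ler_pM2l //; nra.
Qed.

(* A nearest point of [K], in the seminorm defined by the [L t], yields the
   separating functional. *)
Lemma hit_or_separate (T : finType) K (L : T -> 'rV[R]_D -> R) (c : T -> R) :
  compact K ->
  (forall s u v, 0 <= s <= 1 -> K u -> K v -> K (s *: (u - v) + v)) ->
  (forall t, scalar (L t)) ->
  (exists2 v, K v & forall t, L t v = c t) \/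
  (exists (h : T -> R) (gamma : R),
     (forall v, K v -> \sum_t h t * L t v <= gamma) /\
     gamma < \sum_t h t * c t).
Proof.
move=> cK convK hL.
have [->|/set0P K0] := eqVneq K set0.
  (* For empty [K] any bound holds vacuously, so the zero functional separates with [-1 < 0]. *)
  right; exists (fun=> 0), (-1); split=> //.
  by rewrite big1 ?ltrN10 // => t _; rewrite mul0r.
have [|v0 /set_mem Kv0 hmin] :=
    @EVT_min_rV R D (fun v => \sum_t (L t v - c t) ^+ 2) K K0 cK.
  apply: continuous_subspaceT; apply: continuous_big => [|t _ v].
    exact: add_continuous.
  have cL : {for v, continuous (fun v => L t v - c t)}.
    have cl : {for v, continuous (L t)} by apply: scalar_rV_continuous.
    have cc : {for v, continuous (fun _ : 'rV[R]_D => c t)} by exact: cst_continuous.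
    exact: (continuousB cl cc).
  exact: (continuousM cL cL).
have LB t u v : L t (u - v) = L t u - L t v.
  by rewrite addrC -scaleN1r hL mulN1r addrC.
have [F0|F0] := eqVneq (\sum_t (L t v0 - c t) ^+ 2) 0.
  left; exists v0 => // t; apply/eqP; rewrite -subr_eq0 -sqrf_eq0.
  by move/psumr_eq0P : F0 => -> // i _; rewrite sqr_ge0.
(* The normal points from the nearest point to the target. Minimality along the segment from [v0] to
   [v] gives the bound on [K]; the gap at [c] is the squared distance, nonzero by [F0]. *)
right; exists (fun t => c t - L t v0), (\sum_t (c t - L t v0) * L t v0); split.
  move=> v Kv; rewrite -subr_le0 -sumrB.
  apply: (@first_order_le0 _ (\sum_t (L t (v - v0)) ^+ 2)).
    by apply: sumr_ge0 => t _; rewrite sqr_ge0.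
  move=> s hs; have := hmin _ (mem_set (convK _ _ _ hs Kv Kv0)).
  have -> : \sum_t (L t (s *: (v - v0) + v0) - c t) ^+ 2 =
      \sum_t ((L t v0 - c t) + s * L t (v - v0)) ^+ 2.
    by apply: eq_bigr => t _; rewrite hL -addrA addrC.
  rewrite sqr_dist_expand -addrA lerDl.
  have -> : \sum_t ((c t - L t v0) * L t v - (c t - L t v0) * L t v0) =
      - \sum_t (L t v0 - c t) * L t (v - v0).
    by rewrite -sumrN; apply: eq_bigr => t _; rewrite LB; ring.
  lra.
rewrite -subr_gt0 -sumrB.
rewrite (eq_bigr (fun t => (L t v0 - c t) ^+ 2)); last by move=> t _; ring.
by rewrite lt0r F0 sumr_ge0 // => t _; rewrite sqr_ge0.
Qed.

Lemma closed_bounded_coord_compact K (b : R) :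
  closed K -> (forall v, K v -> forall j, `|v 0 j| <= b) -> compact K.
Proof.
move=> clK hb; apply: bounded_closed_compact => //.
exists (Num.max 0 b); split=> [|M hM v Kv /=]; first exact: num_real.
apply: le_trans (ltW hM).
rewrite [leLHS]/Num.norm /= mx_normrE; apply/bigmax_leP; split=> [|[i j] _ /=].
  by rewrite le_max lexx.
by rewrite ord1 le_max hb ?orbT.
Qed.
End Separation.

(** * Instruments form a compact convex set *)

Section RealLinearFunctionals.
Variables (R : realType) (D : nat).
Local Notation C := (R[i]).
Local Open Scope complex_scope.

Definition part (im : bool) (z : C) : R := if im then complex.Im z else complex.Re z.

(** Real-linearity into a complex space: instruments get real coordinates, while their values and
    constraints are complex. *)
Definition cscalar (V : lmodType C) (phi : 'rV[R]_D -> V) : Prop :=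
  forall (a : R) u v, phi (a *: u + v) = a%:C *: phi u + phi v.

Lemma part_linear im (a : R) (x y : C) :
  part im (a%:C * x + y) = a * part im x + part im y.
Proof. by case: im x y => [] [x1 x2] [y1 y2] /=; rewrite mul0r ?subr0 ?addr0. Qed.

Lemma complex_partE (x y : C) : (forall im, part im x = part im y) -> x = y.
Proof.
by move=> h; apply/eqP; rewrite eq_complex (h false : complex.Re x = _) (h true : complex.Im x = _) !eqxx.
Qed.

Lemma cscalar_part (phi : 'rV[R]_D -> C^o) im : cscalar phi ->
  scalar (fun v => part im (phi v)).
Proof. by move=> h a u v /=; rewrite h; apply: part_linear. Qed.

Lemma cscalar_sum (V : lmodType C) (J : Type) (s : seq J) (P : pred J)
    (phi : J -> 'rV[R]_D -> V) :
  (forall j, cscalar (phi j)) -> cscalar (fun v => \sum_(j <- s | P j) phi j v).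
Proof.
move=> h a u v; rewrite scaler_sumr -big_split; apply: eq_bigr => j _.
exact: h.
Qed.

Lemma cscalar_comp (V W : lmodType C) (phi : 'rV[R]_D -> V) (E : V -> W) :
  cscalar phi -> linear E -> cscalar (fun v => E (phi v)).
Proof. by move=> h hE a u v; rewrite h hE. Qed.

Lemma closed_part_ge (phi : 'rV[R]_D -> C^o) im c : cscalar phi ->
  closed [set v | c <= part im (phi v)]%classic.
Proof. by move=> h; apply: closed_halfspace; apply: cscalar_part. Qed.

Lemma closed_part_le (phi : 'rV[R]_D -> C^o) im c : cscalar phi ->
  closed [set v | part im (phi v) <= c]%classic.
Proof.
move=> h.
have -> : [set v | part im (phi v) <= c]%classic = [set v | - c <= - part im (phi v)]%classic.
  by apply/seteqP; split=> v /=; rewrite lerN2.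
apply: closed_halfspace => a u v /=; rewrite (cscalar_part im h) /=.
by rewrite opprD mulrN.
Qed.

Lemma closed_eq_cscalar (phi : 'rV[R]_D -> C^o) (c : C) : cscalar phi ->
  closed [set v | phi v = c]%classic.
Proof.
move=> h.
have -> : [set v | phi v = c]%classic = (\bigcap_(im in setT)
    ([set v | part im c <= part im (phi v)] `&` [set v | part im (phi v) <= part im c]))%classic.
  apply/seteqP; split=> v /=; first by move=> e im _; split=> /=; rewrite e.
  move=> hv; apply: complex_partE => im; have [h1 h2] := hv im I.
  by apply/eqP; rewrite eq_le h1 h2.
apply: closed_bigI => im _; apply: closedI.
  exact: closed_part_ge.
exact: closed_part_le.
Qed.

Lemma closed_ge0_cscalar (phi : 'rV[R]_D -> C^o) : cscalar phi ->
  closed [set v | (0 : C) <= phi v]%classic.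
Proof.
move=> h.
have -> : [set v | (0 : C) <= phi v]%classic =
    ([set v | 0 <= part false (phi v)] `&` ([set v | 0 <= part true (phi v)] `&`
     [set v | part true (phi v) <= 0]))%classic.
  apply/seteqP; split=> v /=; rewrite lecE /=.
    by move=> /andP[/eqP -> ->].
  by move=> [-> [h1 h2]]; rewrite andbT eq_le h1 h2.
apply: closedI; first exact: closed_part_ge.
apply: closedI; first exact: closed_part_ge.
exact: closed_part_le.
Qed.

Section ConeSection.
Variables (J J' : Type) (P : J -> Prop) (phi : J -> 'rV[R]_D -> C^o)
  (psi : J' -> 'rV[R]_D -> C^o) (c : J' -> C).
Hypotheses (hphi : forall j, cscalar (phi j)) (hpsi : forall j, cscalar (psi j)).

(** The shape of the set of instruments: complete positivity supplies the inequalities, trace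
    preservation the equations. *)
Let K := [set v | (forall j, P j -> (0 : C) <= phi j v) /\
                  forall j, psi j v = c j]%classic.

Lemma cone_section_closed : closed K.
Proof.
have -> : K = ((\bigcap_(j in [set j | P j]) [set v | (0 : C) <= phi j v]) `&`
    \bigcap_(j in setT) [set v | psi j v = c j])%classic.
  apply/seteqP; split=> v [h1 h2]; split=> // j; first by move=> _; apply: h2.
  exact: h2.
apply: closedI; apply: closed_bigI => j _.
  exact: closed_ge0_cscalar.
exact: closed_eq_cscalar.
Qed.

Lemma cone_section_convex s u v :
  0 <= s <= 1 -> K u -> K v -> K (s *: (u - v) + v).
Proof.
move=> /andP[s0 s1] [u1 u2] [v1 v2].
have mix (f : 'rV[R]_D -> C^o) : cscalar f ->
    f (s *: (u - v) + v) = s%:C * f u + (1 - s)%:C * f v.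
  move=> hf; rewrite hf [u - v]addrC -scaleN1r hf.
  move: (f u) (f v) => x y.
  change (s%:C * ((-1)%:C * y + x) + y = s%:C * x + (1 - s)%:C * y :> C).
  by rewrite rmorphB rmorphN rmorph1; ring.
split=> j; last by rewrite mix // u2 v2 -mulrDl -rmorphD addrC subrK mul1r.
by move=> Pj; rewrite mix // addr_ge0 // mulr_ge0 ?u1 ?v1 // ler0c // subr_ge0.
Qed.
End ConeSection.
End RealLinearFunctionals.

(** * Entrywise bounds from the Choi matrix *)

Section InstrumentBound.
Variable R : realType.
Local Notation C := (R[i]).

Lemma CP_entry_bound n m (E : 'M[C]_n -> 'M[C]_m) i j a b : CP E ->
  `|E (delta_mx i j) a b| <= E (delta_mx i i) a a + E (delta_mx j j) b b.
Proof.
move=> [lE hE].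
(* The unnormalized maximally entangled vector; the ampliation of [E] sends its projector to the
   Choi matrix, whose entries are those of the [E (delta_mx i j)]. *)
pose u : 'cV[C]_(n * n) := \col_p (idx1 p == idx2 p)%:R.
have hu : psd (u *m adjmx u) by have := psd_gram (adjmx u); rewrite adjmxK.
have choiE i' j' a' b' :
    ampl E (u *m adjmx u) (mxvec_index i' a') (mxvec_index j' b') = E (delta_mx i' j') a' b'.
  rewrite mxE !idx1_mxvec_index !idx2_mxvec_index; congr (E _ _ _).
  apply/matrixP=> p q; rewrite !mxE big_ord1 !mxE.
  rewrite !idx1_mxvec_index !idx2_mxvec_index conjC_nat -natrM mulnb.
  by rewrite (eq_sym i') (eq_sym j').
have := psd_entry_bound (mxvec_index i a) (mxvec_index j b) (hE n _ hu).
by rewrite !choiE.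
Qed.

Lemma psd_delta n (i : 'I_n) : psd (delta_mx i i : 'M[C]_n).
Proof.
have := @psd_gram R 1 n (delta_mx 0 i).
by rewrite adjmx_delta mul_delta_mx.
Qed.

(** Trace preservation bounds the diagonal entries of the Choi matrix by 1, and any entry is bounded
    by the sum of two of these. *)
Lemma instrument_entry_bound (S : finType) n m (E : S -> 'M[C]_n -> 'M[C]_m) s i j a b :
  instrument E -> `|E s (delta_mx i j) a b| <= 2.
Proof.
move=> [hE tE].
have diag k c : E s (delta_mx k k) c c <= 1.
  have p s' : psd (E s' (delta_mx k k)) by apply: CP_psd => //; exact: psd_delta.
  have <- : \tr (delta_mx k k : 'M[C]_n) = 1.
    rewrite /mxtrace (bigD1 k) //= big1 ?addr0 => [|l /negbTE hl].
      by rewrite mxE eqxx.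
    by rewrite mxE hl.
  rewrite -tE raddf_sum (bigD1 s) //= ler_wpDr //.
    by apply: sumr_ge0 => s' _; apply: psd_tr_ge0.
  rewrite /mxtrace (bigD1 c) //= lerDl.
  by apply: sumr_ge0 => l _; apply: psd_diag_ge0.
apply: le_trans (CP_entry_bound i j a b (hE s)) _.
by rewrite -[2]/(1 + 1) lerD.
Qed.
End InstrumentBound.

(** * Real coordinates for instruments *)

Section InstrumentCoordinates.
Variables (R : realType) (S : finType) (n m : nat).
Local Notation C := (R[i]).
Local Open Scope complex_scope.

Definition coords : finType := (S * ('I_n * 'I_n) * ('I_m * 'I_m) * bool)%type.

Definition entry (v : 'rV[R]_#|coords|) (s : S) (i j : 'I_n) (a b : 'I_m) : C :=
  v 0 (enum_rank ((s, (i, j), (a, b), false) : coords)) +i*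
  v 0 (enum_rank ((s, (i, j), (a, b), true) : coords)).

Definition decode (v : 'rV[R]_#|coords|) (s : S) (U : 'M[C]_n) : 'M[C]_m :=
  \matrix_(a, b) \sum_i \sum_j U i j * entry v s i j a b.

Definition encode (E : S -> 'M[C]_n -> 'M[C]_m) : 'rV[R]_#|coords| :=
  \row_k let t := enum_val k in
    part t.2 (E t.1.1.1 (delta_mx t.1.1.2.1 t.1.1.2.2) t.1.2.1 t.1.2.2).

Lemma decode_lin_map v s : lin_map (decode v s).
Proof.
move=> a U V; apply/matrixP=> p q; rewrite !mxE mulr_sumr -big_split.
apply: eq_bigr => i _; rewrite mulr_sumr -big_split; apply: eq_bigr => j _ /=.
by rewrite !mxE mulrDl mulrA.
Qed.

Lemma decode_delta v s i j a b : decode v s (delta_mx i j) a b = entry v s i j a b.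
Proof.
rewrite mxE (bigD1 i) //= [X in _ + X]big1 ?addr0; last first.
  by move=> k /negbTE hk; apply: big1 => l _; rewrite mxE hk mul0r.
rewrite (bigD1 j) //= big1 ?addr0; first by rewrite mxE !eqxx mul1r.
by move=> l /negbTE hl; rewrite mxE hl andbF mul0r.
Qed.

Lemma encodeK E : (forall s, lin_map (E s)) ->
  forall s U, decode (encode E) s U = E s U.
Proof.
move=> hE s U; rewrite (lin_mapE _ (hE s)) (lin_mapE _ (decode_lin_map _ s)).
apply: eq_bigr => i _; apply: eq_bigr => j _; congr (_ *: _).
apply/matrixP=> a b; rewrite decode_delta; apply: complex_partE.
by case; rewrite /= !mxE !enum_rankK.
Qed.

Lemma decode_cscalar s U : cscalar (fun v => decode v s U).
Proof.
move=> c u v; apply/matrixP=> a b; rewrite !mxE mulr_sumr -big_split.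
apply: eq_bigr => i _; rewrite mulr_sumr -big_split; apply: eq_bigr => j _ /=.
have -> : entry (c *: u + v) s i j a b = c%:C * entry u s i j a b + entry v s i j a b.
  by apply: complex_partE => im; rewrite part_linear; case: im; rewrite /= !mxE.
by rewrite mulrDr mulrCA.
Qed.

Definition instrument_codes : set 'rV[R]_#|coords| := [set v | instrument (decode v)]%classic.

(** The dependent pair ranges over all ancilla dimensions, test operators and test vectors, so
    complete positivity becomes one family of linear inequalities. *)
Let qform (t : {k : nat & (S * 'M[C]_(k * n) * 'cV[C]_(k * m))%type})
    (v : 'rV[R]_#|coords|) : C^o :=
  let: existT k (s, U, w) := t in (adjmx w *m ampl (decode v s) U *m w) 0 0.

Let psd_arg (t : {k : nat & (S * 'M[C]_(k * n) * 'cV[C]_(k * m))%type}) : Prop :=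
  let: existT k (s, U, w) := t in psd U.

Lemma instrument_codesE : instrument_codes =
  [set v | (forall t, psd_arg t -> (0 : C) <= qform t v) /\
           forall U : 'M[C]_n, \tr (\sum_s decode v s U) = \tr U]%classic.
Proof.
apply/seteqP; split=> v [h1 h2]; split=> //.
  by move=> [k [[s U] w]] /= hU; have [_] := h1 s; apply.
move=> s; split=> [|k U hU w]; first exact: decode_lin_map.
by have := h1 (existT _ k (s, U, w)); apply.
Qed.

Lemma qform_cscalar t : cscalar (qform t).
Proof.
case: t => k [[s U] w] c u v /=.
have -> : ampl (decode (c *: u + v) s) U =
    c%:C *: ampl (decode u s) U + ampl (decode v s) U.
  by apply/matrixP=> p q; rewrite [LHS]mxE decode_cscalar !mxE.
by rewrite mulmxDr mulmxDl -scalemxAr -scalemxAl !mxE.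
Qed.

Lemma trace_cscalar (U : 'M[C]_n) :
  cscalar (fun v => \tr (\sum_s decode v s U) : C^o).
Proof.
move=> c u v /=.
rewrite (cscalar_sum _ _ (fun s => @decode_cscalar s U)).
by rewrite mxtraceD mxtraceZ.
Qed.

Lemma instrument_codes_convex s u v : 0 <= s <= 1 ->
  instrument_codes u -> instrument_codes v -> instrument_codes (s *: (u - v) + v).
Proof.
rewrite instrument_codesE; apply: cone_section_convex.
  exact: qform_cscalar.
exact: trace_cscalar.
Qed.

Lemma instrument_codes_compact : compact instrument_codes.
Proof.
apply: (@closed_bounded_coord_compact _ _ _ 2).
  rewrite instrument_codesE; apply: cone_section_closed.
    exact: qform_cscalar.
  exact: trace_cscalar.
move=> v hv k; rewrite -[k]enum_valK.
case: (enum_val k) => [[[s [i j]] [a b]] im].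
have := @instrument_entry_bound R S n m (decode v) s i j a b hv.
rewrite decode_delta => hb.
rewrite -lecR; have -> : 2%:C = 2 :> C by rewrite rmorph_nat.
apply: le_trans hb.
have -> : v 0 (enum_rank ((s, (i, j), (a, b), im) : coords)) = part im (entry v s i j a b).
  by case: im.
case: im; rewrite /part; last exact: (normc_ge_Re (entry v s i j a b)).
(* Up to sign, the imaginary part is the real part of the entry times ['i], which has the same
   modulus. *)
rewrite -[X in `|X|]opprK normrN -(ReiNIm (entry v s i j a b)).
apply: le_trans (normc_ge_Re _) _.
by rewrite normrM (_ : `|'i%C| = 1 :> C) ?mulr1 // normc_def /= expr0n expr1n add0r sqrtr1.
Qed.

Lemma instrument_encode E : instrument E -> instrument_codes (encode E).
Proof.
move=> [hE tE].
have dK s U : decode (encode E) s U = E s U by apply: encodeK => t; case: (hE t).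
split=> [s|U]; last first.
  by rewrite -tE; congr (\tr _); apply: eq_bigr => s _; rewrite dK.
split=> [|k U hU]; first exact: decode_lin_map.
have [_ /(_ k U hU)] := hE s.
by congr psd; apply/matrixP=> p q; rewrite [LHS]mxE [RHS]mxE dK.
Qed.
End InstrumentCoordinates.

(** * The separating game *)

Section SeparatingGame.
Variables (R : realType) (n n' : nat) (A X B Y : finType).
Local Notation C := (R[i]).
Local Open Scope complex_scope.
Variables (M : A -> X -> 'M[C]_n) (N : B -> Y -> 'M[C]_n').

Local Notation strategy := ({ffun Y -> X} * {ffun A * Y -> B})%type.

(** The outcome is itself the pair of functions to apply, so the outcome set is one fixed finite
    type and instruments live in a fixed finite dimension. *)
Definition canonical_sim (E : strategy -> 'M[C]_n' -> 'M[C]_n) :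
    B -> Y -> 'M[C]_n' :=
  det_sim E (fun s y => s.1 y) (fun s a y => s.2 (a, y)) M.

Lemma tdual_suml (I : Type) (r : seq I) (P : pred I) (E : I -> 'M[C]_n' -> 'M[C]_n) V :
  tdual (fun U => \sum_(i <- r | P i) E i U) V = \sum_(i <- r | P i) tdual (E i) V.
Proof.
apply/matrixP=> i j; rewrite summxE mxE mulmx_suml raddf_sum.
by apply: eq_bigr => k _; rewrite mxE.
Qed.

(** Outcomes inducing the same pair of functions can be merged by adding their maps. *)
Lemma det_simulates_canonical (K : B -> Y -> 'M[C]_n') : det_simulates M K ->
  exists2 E, instrument E & forall b y, K b y = canonical_sim E b y.
Proof.
case=> I [E0 [f [g [[hE tE] hK]]]].
pose code i : strategy := ([ffun y => f i y], [ffun t => g i t.1 t.2]).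
exists (fun s U => \sum_(i | code i == s) E0 i U).
  split=> [s|U]; first by apply: CP_sum.
  by rewrite -tE; congr (\tr _); rewrite [RHS](partition_big code predT).
move=> b y; rewrite hK /canonical_sim /det_sim.
rewrite (partition_big code predT) //=; apply: eq_bigr => s _.
under [RHS]eq_bigr do rewrite tdual_suml.
rewrite [RHS]exchange_big; apply: eq_bigr => i /eqP <-; rewrite /= ffunE.
by apply: eq_bigl => a; rewrite ffunE.
Qed.

Lemma canonical_sim_cscalar b y i j :
  cscalar (fun v => canonical_sim (decode v) b y i j : C^o).
Proof.
apply: (@cscalar_comp _ _ _ _ (fun v => canonical_sim (decode v) b y)
  (fun U : 'M[C]_n' => U i j : C^o)); last by move=> c U V; rewrite !mxE.
apply: cscalar_sum => s; apply: cscalar_sum => a c u v.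
apply/matrixP=> p q; rewrite !mxE decode_cscalar mulmxDl mxtraceD.
by rewrite -scalemxAl mxtraceZ.
Qed.

Lemma Re_sum (J : Type) (r : seq J) (P : pred J) (F : J -> C) :
  complex.Re (\sum_(j <- r | P j) F j) = \sum_(j <- r | P j) complex.Re (F j).
Proof. by elim/big_rec2: _ => [|j x z _ <-] //; case: (F j) z => ? ? []. Qed.

Definition score (G : Y -> B -> 'M[C]_n') (K : B -> Y -> 'M[C]_n') : C :=
  \sum_y \sum_b \tr (G y b *m K b y).

Lemma score_of_coefficients (h : B * Y * ('I_n' * 'I_n') * bool -> R) :
  exists G, forall K : B -> Y -> 'M[C]_n',
  \sum_t h t * part t.2 (K t.1.1.1 t.1.1.2 t.1.2.1 t.1.2.2) =
    complex.Re (score G K).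
Proof.
(* The minus sign makes the real part of the product pair real with real and imaginary with
   imaginary parts; the transposed indices match the trace. *)
exists (fun y b => \matrix_(j, i) (h (b, y, (i, j), false) -i* h (b, y, (i, j), true))).
move=> K; rewrite /score.
transitivity (\sum_t h (t.1.1.1, t.1.1.2, (t.1.2.1, t.1.2.2), t.2) *
    part t.2 (K t.1.1.1 t.1.1.2 t.1.2.1 t.1.2.2)).
  by apply: eq_bigr => [[[[b y] [i j]] im]].
rewrite -(pair_bigA _ (fun u im => h (u.1.1, u.1.2, (u.2.1, u.2.2), im) * part im (K u.1.1 u.1.2 u.2.1 u.2.2))) /=.
rewrite -(pair_bigA _ (fun u w => \sum_im h (u.1, u.2, (w.1, w.2), im) * part im (K u.1 u.2 w.1 w.2))) /=.
rewrite -(pair_bigA _ (fun b y => \sum_w \sum_im h (b, y, (w.1, w.2), im) * part im (K b y w.1 w.2))) /=.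
rewrite exchange_big Re_sum; apply: eq_bigr => y _.
rewrite Re_sum; apply: eq_bigr => b _.
rewrite -(pair_bigA _ (fun i j => \sum_im h (((b, y), (i, j)), im) * part im (K b y i j))) /=.
rewrite exchange_big /mxtrace Re_sum; apply: eq_bigr => j _.
rewrite mxE Re_sum; apply: eq_bigr => i _; rewrite mxE big_bool /=.
case: (K b y i j) => p q /=.
by rewrite mulNr opprK addrC.
Qed.

Lemma det_simulates_or_separated : det_simulates M N \/
  exists (G : Y -> B -> 'M[C]_n') (gamma : R),
    (forall K, det_simulates M K -> complex.Re (score G K) <= gamma) /\
    gamma < complex.Re (score G N).
Proof.
have [[v hv vN]|[h [gamma [hle hlt]]]] :=
  @hit_or_separate R _ (B * Y * ('I_n' * 'I_n') * bool)%type
    (@instrument_codes R strategy n' n)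
    (fun t v => part t.2 (canonical_sim (decode v) t.1.1.1 t.1.1.2 t.1.2.1 t.1.2.2))
    (fun t => part t.2 (N t.1.1.1 t.1.1.2 t.1.2.1 t.1.2.2))
    (@instrument_codes_compact _ _ _ _)
    (@instrument_codes_convex _ _ _ _)
    (fun t => cscalar_part t.2 (canonical_sim_cscalar _ _ _ _)).
- left; exists strategy, (decode v), (fun (s : strategy) y => s.1 y),
    (fun (s : strategy) a y => s.2 (a, y)).
  split=> // b y; apply/matrixP=> i j; apply: complex_partE => im.
  by rewrite -(vN (b, y, (i, j), im)).
- have [G hG] := score_of_coefficients h.
  right; exists G, gamma; split=> [K|]; last by rewrite -hG.
  move=> /det_simulates_canonical [E hE hK]; rewrite -hG.
  apply: le_trans (hle _ (instrument_encode hE)).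
  apply: ler_sum => t _; rewrite hK.
  suff -> : canonical_sim E = canonical_sim (decode (encode E)) by [].
  apply/funext => b; apply/funext => y; apply: eq_bigr => s _; apply: eq_bigr => a _.
  have lE s' : lin_map (E s') by case: hE => /(_ s') [].
  apply/matrixP=> i j.
  by rewrite [LHS]mxE [RHS]mxE encodeK.
Qed.

(** * From a separating functional to a guessing game *)

Section Game.
Variables (G : Y -> B -> 'M[C]_n') (mu : R) (y0 : Y) (b0 : B).
Hypotheses (n'_gt0 : (0 < n')%N) (mu_ge1 : 1 <= mu).

(* [1 + G^* + G + G^* G = (1 + G)^* (1 + G)] is positive, so adding
   [shift y] makes the hermitian part of every [G y b] positive; as [shift]
   does not depend on [b], it contributes the same amount to all PMDs. *)
Definition shift (y : Y) : 'M[C]_n' :=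
  mu%:C%:M + \sum_b (1%:M + adjmx (G y b) *m G y b).

Definition game (y : Y) (b : B) : 'M[C]_n' := shift y + (G y b + adjmx (G y b)).

Lemma psd_gramD1 y b : psd (1%:M + adjmx (G y b) *m G y b).
Proof. by apply: psdD; [exact: psd1 | exact: psd_gram]. Qed.

Lemma psd_mu : psd (mu%:C%:M : 'M[C]_n').
Proof.
rewrite -scalemx1; apply: psdZ; last exact: psd1.
by rewrite ler0c (le_trans ler01).
Qed.

Lemma psd_shift_mu y : psd (shift y - mu%:C%:M).
Proof.
rewrite /shift addrC addKr; apply: psd_sum => b _; exact: psd_gramD1.
Qed.

Lemma psd_game_mu y b : psd (game y b - mu%:C%:M).
Proof.
rewrite /game /shift (bigD1 b) //= addrAC [mu%:C%:M + _]addrC addrK addrAC.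
apply: psdD; last by apply: psd_sum => b' _; exact: psd_gramD1.
have -> : 1%:M + adjmx (G y b) *m G y b + (G y b + adjmx (G y b)) =
    adjmx (1%:M + G y b) *m (1%:M + G y b).
  rewrite adjmxD adjmx1 mulmxDl !mulmxDr !mul1mx mulmx1.
  by rewrite -!addrA; congr (_ + _); rewrite addrC -addrA.
exact: psd_gram.
Qed.

Lemma psd_game y b : psd (game y b).
Proof.
rewrite -[game y b](subrK mu%:C%:M); apply: psdD; last exact: psd_mu.
exact: psd_game_mu.
Qed.

Lemma mu_le_trace (U : 'M[C]_n') : psd (U - mu%:C%:M) -> mu%:C <= \tr U.
Proof.
move=> /psd_tr_ge0; rewrite raddfB /= subr_ge0; apply: le_trans.
rewrite mxtrace_scalar -(prednK n'_gt0) mulrS lerDl mulrn_wge0 //.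
by rewrite ler0c (le_trans ler01).
Qed.

Definition shift_total : C := \sum_y \tr (shift y).
Definition game_total : C := \sum_y \sum_b \tr (game y b).

Lemma mu_ge0C : 0 <= mu%:C.
Proof. by rewrite ler0c (le_trans ler01). Qed.

Lemma mu_le_shift_total : mu%:C <= shift_total.
Proof.
rewrite /shift_total (bigD1 y0) //= ler_wpDr //.
  apply: sumr_ge0 => y _; apply: le_trans mu_ge0C _.
  exact/mu_le_trace/psd_shift_mu.
exact/mu_le_trace/psd_shift_mu.
Qed.

Lemma mu_le_game_total : mu%:C <= game_total.
Proof.
rewrite /game_total (bigD1 y0) //= (bigD1 b0) //= -addrA ler_wpDr //.
  rewrite addr_ge0 ?sumr_ge0 // => [b _|y _]; last apply: sumr_ge0 => b _;
  by apply: psd_tr_ge0; exact: psd_game.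
exact/mu_le_trace/psd_game_mu.
Qed.

(** Since [K] sums to the identity over outcomes, [shift] contributes a constant; since [K] is
    hermitian, [adjmx G] contributes the conjugate score. *)
Lemma score_game (K : B -> Y -> 'M[C]_n') : PMD K ->
  score game K = shift_total + 2 * (complex.Re (score G K))%:C.
Proof.
move=> [hK tK]; rewrite -addcJ /shift_total /score addrA.
have conjE : (\sum_y \sum_b \tr (G y b *m K b y))^*%C =
    \sum_y \sum_b \tr (adjmx (G y b) *m K b y).
  rewrite rmorph_sum; apply: eq_bigr => y _; rewrite rmorph_sum; apply: eq_bigr => b _.
  rewrite -[RHS]mxtrace_mulC -{2}(psd_herm (hK b y)) -adjmxM mxtrace_adj.
  by [].
rewrite conjE -!big_split; apply: eq_bigr => y _ /=.
rewrite -[in RHS](mulmx1 (shift y)) -(tK y) mxtrace_mul_sumr -!big_split.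
by apply: eq_bigr => b _ /=; rewrite /game !mulmxDl !mxtraceD !addrA.
Qed.

Definition normalized_game y b : 'M[C]_n' := game_total^-1 *: game y b.

Lemma game_total_gt0 : 0 < game_total.
Proof.
apply: lt_le_trans mu_le_game_total.
by rewrite -[0]/(0%:C) ltcR (lt_le_trans ltr01).
Qed.

Lemma normalized_guessing_game : guessing_game normalized_game.
Proof.
split=> [y b|].
  by apply: psdZ; [rewrite invr_ge0 ltW ?game_total_gt0 | exact: psd_game].
under eq_bigr do (under eq_bigr do rewrite mxtraceZ; rewrite -mulr_sumr).
by rewrite -mulr_sumr mulVf // gt_eqF ?game_total_gt0.
Qed.

Lemma score_normalized (K : B -> Y -> 'M[C]_n') : PMD K ->
  score normalized_game K =
    ((complex.Re shift_total + 2 * complex.Re (score G K)) / complex.Re game_total)%:C.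
Proof.
move=> hK.
have -> : score normalized_game K = game_total^-1 * score game K.
  rewrite /score mulr_sumr; apply: eq_bigr => y _; rewrite mulr_sumr.
  by apply: eq_bigr => b _; rewrite -scalemxAl mxtraceZ.
rewrite score_game // mulrC.
have rS : shift_total = (complex.Re shift_total)%:C.
  by rewrite RRe_real // ger0_real // (le_trans mu_ge0C) // mu_le_shift_total.
have rT : game_total = (complex.Re game_total)%:C.
  by rewrite RRe_real // ger0_real // ltW // game_total_gt0.
by rewrite {1}rS {1}rT rmorphM fmorphV rmorphD rmorphM rmorph_nat.
Qed.
End Game.

Lemma separated_guessing_game (G : Y -> B -> 'M[C]_n') (gamma : R) (y0 : Y) :
  (0 < n')%N -> PMD M -> PMD N ->
  (forall K, det_simulates M K -> complex.Re (score G K) <= gamma) ->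
  gamma < complex.Re (score G N) ->
  exists2 rho : Y -> B -> 'M[C]_n', guessing_game rho & Pguess M rho < Pguess N rho.
Proof.
move=> n'0 hM hN hle hlt.
(* Without outcomes the empty sum would equal the identity on a nonzero space. *)
have [b0 _|B0] := pickP (@predT B); last first.
  have := hN.2 y0; rewrite big_pred0 // => /matrixP /(_ (Ordinal n'0) (Ordinal n'0)).
  by rewrite !mxE eqxx => /esym/eqP; rewrite oner_eq0.
(* With [mu <= s] this makes [s + 2 * gamma] positive, as needed for the nonnegative bound in
   [Pguess_le]. *)
pose mu : R := 1 + 2 * `|gamma|.
have mu1 : 1 <= mu by rewrite lerDl mulr_ge0.
have hrho := normalized_guessing_game G y0 b0 n'0 mu1.
have hval := score_normalized G y0 b0 n'0 mu1.
exists (normalized_game G mu) => //.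
set s := complex.Re (shift_total G mu) in hval.
set t := complex.Re (game_total G mu) in hval.
have t0 : 0 < t.
  have := game_total_gt0 G y0 b0 n'0 mu1.
  by rewrite ltcE => /andP[].
have smu : mu <= s.
  have := mu_le_shift_total G y0 n'0 mu1.
  by rewrite lecE => /andP[].
apply: (@lt_le_trans _ _ ((s + 2 * complex.Re (score G N)) / t)); last first.
  apply: Pguess_ge => //; apply/success_valuesP; exists N; split; first exact: det_simulates_refl.
  by rewrite -hval.
apply: (@le_lt_trans _ _ ((s + 2 * gamma) / t)); last first.
  by rewrite ltr_pM2r ?invr_gt0 // ltrD2l ltr_pM2l.
have gN : - `|gamma| <= gamma by rewrite lerNl -normrN ler_norm.
apply: Pguess_le.
  by rewrite divr_ge0 ?(ltW t0) //; rewrite /mu in smu; lra.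
move=> v /success_valuesP [K [hK hv]].
move: hv; rewrite -/(score _ K) hval; last exact: det_simulates_PMD hM hK.
move=> /complexI ->.
by rewrite ler_pM2r ?invr_gt0 // lerD2l ler_pM2l ?hle.
Qed.
End SeparatingGame.

Theorem theorem1 (R : realType) (n n' : nat) (A X B Y : finType)
  (M : A -> X -> 'M[R[i]]_n) (N : B -> Y -> 'M[R[i]]_n') :
  (0 < n)%N -> (0 < n')%N ->
  PMD M -> PMD N ->
  (simulates M N <->
     (forall (d : nat) (W Z : finType) (rho : W -> Z -> 'M[R[i]]_d),
        guessing_game rho -> Pguess N rho <= Pguess M rho))
  /\
  (simulates M N <->
     (forall rho : Y -> B -> 'M[R[i]]_n',
        guessing_game rho -> Pguess N rho <= Pguess M rho)).
Proof.
move=> n0 n'0 hM hN.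
have sim_le d (W Z : finType) (rho : W -> Z -> 'M[R[i]]_d) :
    simulates M N -> guessing_game rho -> Pguess N rho <= Pguess M rho.
  by move=> hMN hrho; apply: simulates_Pguess_le.
have le_sim : (forall rho : Y -> B -> 'M[R[i]]_n',
    guessing_game rho -> Pguess N rho <= Pguess M rho) -> simulates M N.
  (* A game with questions in [Y] needs some [y0]; for empty [Y] simulation is immediate. *)
  move=> hle; have [y0 _|Y0] := pickP (@predT Y); last first.
    by apply: simulates_no_program => // y; have := Y0 y.
  have [/simulates_of_det //|[G [gamma [hG hGN]]]] := det_simulates_or_separated M N.
  have [rho hrho] := separated_guessing_game y0 n'0 hM hN hG hGN.
  by rewrite ltNge hle.
split; split=> [hMN|hle].
- by move=> d W Z rho; apply: sim_le.
- by apply: le_sim => rho; apply: hle.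
- by move=> rho; apply: sim_le.
- exact: le_sim.
Qed.
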